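(* For every commutative monoid $M$, the following identities of monoid homomorphisms hold: (associativity) $\nabla_M\circ(\nabla_M\otimes\mathrm{id}_{FM})=\nabla_M\circ(\mathrm{id}_{FM}\otimes\nabla_M)\colon FM\otimes FM\otimes FM\to FM$; (unit) $\nabla_M\circ(\mathrm{id}_{FM}\otimes\eta_M)=\mathrm{id}_{FM}\colon FM\to FM$; (commutativity) $\nabla_M\circ\sigma_{FM,FM}=\nabla_M\colon FM\otimes FM\to FM$.
   Context: $(\mathsf{CMon},\otimes,\mathbb{N})$ is the symmetric monoidal category of commutative monoids with the usual tensor product (universal for maps that are additive and zero-preserving in each variable) and symmetry $\sigma$; associators and unitors are treated as identities, so $FM\otimes\mathbb{N}$ is identified with $FM$. For a commutative monoid $(M,+,0)$, let $F_0M$ be the set of formal expressions freely generated inductively by: $0$; $1$; $x_m$ for each $m\in M$; $(a+b)$ and $(ab)$ for $a,b\in F_0M$; $f(a)$ for $a\in F_0M$. Let $\sim$ be the smallest equivalence relation on $F_0M$ such that for all $a,b,c\in F_0M$ and $m,n\in M$: $((a+b)+c)\sim(a+(b+c))$; $(a+0)\sim a$; $(a+b)\sim(b+a)$; $((ab)c)\sim(a(bc))$; $(a1)\sim a$; $(ab)\sim(ba)$; $((a+b)c)\sim((ac)+(bc))$; $(0a)\sim 0$; $x_0\sim 0$; $(x_m+x_n)\sim x_{m+n}$; and $a\sim b$ implies $(a+c)\sim(b+c)$, $(ac)\sim(bc)$, $f(a)\sim f(b)$. Set $FM:=F_0M/\sim$, with $[a]$ the class of $a$; it is a commutative rig (commutative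 semiring with $0$ and $1$) with $[a]+[b]=[(a+b)]$, $[a][b]=[(ab)]$, zero $[0]$, unit $[1]$, viewed as a commutative monoid under $+$. $\eta_M\colon\mathbb{N}\to FM$ is defined by $\eta_M(k)=k[1]$, and $\nabla_M\colon FM\otimes FM\to FM$ is the unique monoid homomorphism with $\nabla_M([a]\otimes[b])=[a][b]$ for all $[a],[b]\in FM$. *)

(* Defs.v *)
From HB Require Import structures.
From mathcomp Require Import all_boot all_algebra.
From mathcomp Require Import boolp.

Set Implicit Arguments.
Unset Strict Implicit.
Unset Printing Implicit Defensive.

Import GRing.Theory.
Local Open Scope ring_scope.
Local Open Scope quotient_scope.

(** Commutative monoids are [nmodType]s and their homomorphisms are
    [{additive A -> B}].  The choice structure that [nmodType] carries is no
    restriction: under the axioms of [boolp] every type has one. *)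

Lemma additive_ext (A B : nmodType) (f g : {additive A -> B}) : f =1 g -> f = g.
Proof.
move=> /funext; case: f => f [[hf]]; case: g => g [[hg]] /= efg.
by move: efg hf hg => -> hf hg; rewrite (Prop_irrelevance hf hg).
Qed.

Section Tensor.
Variables A B : nmodType.

Inductive tensor_expr : Type :=
| TZero
| TPure of A & B
| TAdd of tensor_expr & tensor_expr.

HB.instance Definition _ := gen_eqMixin tensor_expr.
HB.instance Definition _ := gen_choiceMixin tensor_expr.

Inductive tensor_rel : tensor_expr -> tensor_expr -> Prop :=
| tensor_refl s : tensor_rel s s
| tensor_sym s t : tensor_rel s t -> tensor_rel t s
| tensor_trans s t u : tensor_rel s t -> tensor_rel t u -> tensor_rel s u
| tensor_addA s t u : tensor_rel (TAdd s (TAdd t u)) (TAdd (TAdd s t) u)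
| tensor_addC s t : tensor_rel (TAdd s t) (TAdd t s)
| tensor_add0 s : tensor_rel (TAdd TZero s) s
| tensor_pureDl a a' b :
    tensor_rel (TPure (a + a') b) (TAdd (TPure a b) (TPure a' b))
| tensor_pureDr a b b' :
    tensor_rel (TPure a (b + b')) (TAdd (TPure a b) (TPure a b'))
| tensor_pure0l b : tensor_rel (TPure 0 b) TZero
| tensor_pure0r a : tensor_rel (TPure a 0) TZero
| tensor_congr s t u : tensor_rel s t -> tensor_rel (TAdd s u) (TAdd t u).

Definition tensor_relb (s t : tensor_expr) : bool := `[< tensor_rel s t >].

Lemma tensor_relb_equiv : equiv_class_of tensor_relb.
Proof.
split=> [s|s t|t s u].
- exact/asboolP/tensor_refl.
- by apply/asboolP/asboolP => /tensor_sym.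
- by move=> /asboolP st /asboolP tu; apply/asboolP/(tensor_trans st tu).
Qed.

Canonical tensor_equiv := EquivRelPack tensor_relb_equiv.

Definition tensor : Type := {eq_quot tensor_equiv}.
HB.instance Definition _ := Choice.on tensor.
HB.instance Definition _ := EqQuotient.on tensor.

Definition tensor_class (s : tensor_expr) : tensor := \pi_tensor s.

Lemma tensor_eqP (s t : tensor_expr) :
  (tensor_class s = tensor_class t) <-> tensor_rel s t.
Proof. by split=> [/eqmodP/asboolP //|st]; apply/eqmodP/asboolP. Qed.

Definition tensor_zero : tensor := tensor_class TZero.
Definition tensor_add (x y : tensor) : tensor := tensor_class (TAdd (repr x) (repr y)).
Definition tpure (a : A) (b : B) : tensor := tensor_class (TPure a b).

Lemma tensor_congr2 s s' t t' : tensor_rel s s' -> tensor_rel t t' ->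
  tensor_rel (TAdd s t) (TAdd s' t').
Proof.
move=> ss' tt'; apply: (tensor_trans (tensor_congr _ ss')).
apply: (tensor_trans (tensor_addC _ _)).
by apply: (tensor_trans (tensor_congr _ tt')); exact: tensor_addC.
Qed.

Lemma tensor_addE s t : tensor_add (tensor_class s) (tensor_class t) = tensor_class (TAdd s t).
Proof. by apply/tensor_eqP/tensor_congr2; apply/tensor_eqP; exact: reprK. Qed.

Lemma tensor_classW (P : tensor -> Prop) :
  (forall s, P (tensor_class s)) -> forall x, P x.
Proof. by move=> Ps; elim/quotW. Qed.

Lemma tensor_addA_subproof : associative tensor_add.
Proof.
elim/tensor_classW=> s; elim/tensor_classW=> t; elim/tensor_classW=> u.
by rewrite !tensor_addE; apply/tensor_eqP/tensor_addA.
Qed.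

Lemma tensor_addC_subproof : commutative tensor_add.
Proof.
elim/tensor_classW=> s; elim/tensor_classW=> t.
by rewrite !tensor_addE; apply/tensor_eqP/tensor_addC.
Qed.

Lemma tensor_add0_subproof : left_id tensor_zero tensor_add.
Proof.
by elim/tensor_classW=> s; rewrite tensor_addE; apply/tensor_eqP/tensor_add0.
Qed.

HB.instance Definition _ := GRing.isNmodule.Build tensor
  tensor_addA_subproof tensor_addC_subproof tensor_add0_subproof.

Lemma tensor_piD s t : tensor_class (TAdd s t) = tensor_class s + tensor_class t.
Proof. by rewrite -tensor_addE. Qed.

End Tensor.

Definition biadditive (A B C : nmodType) (f : A -> B -> C) : Prop :=
  (forall b, nmod_morphism (f^~ b)) /\ (forall a, nmod_morphism (f a)).

Lemma tpure_biadditive (A B : nmodType) : biadditive (@tpure A B).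
Proof.
split=> [b|a]; (split; [|move=> x y; rewrite /tpure -tensor_piD]);
  apply/tensor_eqP.
- exact: tensor_pure0l.
- exact: tensor_pureDl.
- exact: tensor_pure0r.
- exact: tensor_pureDr.
Qed.

Section Lift.
Variables (A B C : nmodType) (f : A -> B -> C) (f_bi : biadditive f).

Fixpoint tensor_eval (s : tensor_expr A B) : C :=
  match s with
  | TZero => 0
  | TPure a b => f a b
  | TAdd s t => tensor_eval s + tensor_eval t
  end.

Lemma tensor_eval_rel s t : tensor_rel s t -> tensor_eval s = tensor_eval t.
Proof.
case: f_bi => fl fr.
elim=> //= {s t}.
- by move=> s t u _ -> _ ->.
- by move=> s t u; rewrite addrA.
- by move=> s t; rewrite addrC.
- by move=> s; rewrite add0r.
- by move=> a a' b; rewrite (fl b).2.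
- by move=> a b b'; rewrite (fr a).2.
- by move=> b; rewrite (fl b).1.
- by move=> a; rewrite (fr a).1.
- by move=> s t u _ ->.
Qed.

Definition tensor_lift_fun of biadditive f :=
  fun x : tensor A B => tensor_eval (repr x).

Lemma tensor_lift_funE s : tensor_lift_fun f_bi (tensor_class s) = tensor_eval s.
Proof. by apply/tensor_eval_rel/tensor_eqP; exact: reprK. Qed.

Lemma tensor_lift_morphism : nmod_morphism (tensor_lift_fun f_bi).
Proof.
split; first exact: (tensor_lift_funE (TZero A B)).
elim/tensor_classW=> s; elim/tensor_classW=> t.
by rewrite -tensor_piD !tensor_lift_funE.
Qed.

HB.instance Definition _ :=
  GRing.isNmodMorphism.Build (tensor A B) C (tensor_lift_fun f_bi)
    tensor_lift_morphism.

Definition tensor_lift : {additive tensor A B -> C} := tensor_lift_fun f_bi.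

Lemma tensor_liftE a b : tensor_lift (tpure a b) = f a b.
Proof. exact: tensor_lift_funE. Qed.

End Lift.

Lemma tensor_hom_ext (A B C : nmodType) (g h : {additive tensor A B -> C}) :
  (forall a b, g (tpure a b) = h (tpure a b)) -> g = h.
Proof.
move=> gh; apply: additive_ext; elim/tensor_classW; elim=> [|a b|s IHs t IHt].
- by rewrite -[tensor_class _]/(0 : tensor A B) !raddf0.
- exact: gh.
- by rewrite tensor_piD !raddfD IHs IHt.
Qed.

Section TensorMap.
Variables (A A' B B' : nmodType).
Variables (f : {additive A -> A'}) (g : {additive B -> B'}).

Lemma tensor_map_biadditive : biadditive (fun a b => tpure (f a) (g b)).
Proof.
have [pl pr] := tpure_biadditive A' B'.
split=> [b|a]; split=> [|x y]; rewrite ?raddf0 ?raddfD.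
- by rewrite (pl _).1.
- by rewrite (pl _).2.
- by rewrite (pr _).1.
- by rewrite (pr _).2.
Qed.

Definition tensor_map : {additive tensor A B -> tensor A' B'} :=
  tensor_lift tensor_map_biadditive.

Lemma tensor_mapE a b : tensor_map (tpure a b) = tpure (f a) (g b).
Proof. exact: tensor_liftE. Qed.

End TensorMap.

Section Symmetry.
Variables A B : nmodType.

Lemma tensor_swap_biadditive : biadditive (fun (a : A) (b : B) => tpure b a).
Proof. by have [pl pr] := tpure_biadditive B A. Qed.

Definition tensor_swap : {additive tensor A B -> tensor B A} :=
  tensor_lift tensor_swap_biadditive.

Lemma tensor_swapE a b : tensor_swap (tpure a b) = tpure b a.
Proof. exact: tensor_liftE. Qed.

End Symmetry.

Section Associator.
Variables A B C : nmodType.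

Lemma tensor_assoc_slice_biadditive (c : C) :
  biadditive (fun (a : A) (b : B) => tpure a (tpure b c)).
Proof.
have [pl pr] := tpure_biadditive A (tensor B C).
have [ql _] := tpure_biadditive B C.
split=> [b|a]; first exact: pl.
split=> [|x y]; first by rewrite (ql c).1 (pr a).1.
by rewrite (ql c).2 (pr a).2.
Qed.

Lemma tensor_assoc_biadditive : biadditive
  (fun (x : tensor A B) (c : C) => tensor_lift (tensor_assoc_slice_biadditive c) x).
Proof.
have [pl pr] := tpure_biadditive A (tensor B C).
have [_ qr] := tpure_biadditive B C.
split=> [c|]; first by split=> [|x y]; rewrite ?raddf0 ?raddfD.
elim/tensor_classW; elim=> [|a b|s IHs t IHt].
- by rewrite -[tensor_class _]/(0 : tensor A B); split=> [|c d]; rewrite !raddf0 ?addr0.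
- rewrite -[tensor_class _]/(tpure a b).
  by split=> [|c d]; rewrite !tensor_liftE ?(qr b).1 ?(pr a).1 ?(qr b).2 ?(pr a).2.
- rewrite tensor_piD; split=> [|c d]; rewrite !raddfD ?IHs.1 ?IHt.1 ?addr0 //.
  by rewrite IHs.2 IHt.2 addrACA.
Qed.

Definition tensor_assoc :
    {additive tensor (tensor A B) C -> tensor A (tensor B C)} :=
  tensor_lift tensor_assoc_biadditive.

Lemma tensor_assocE a b c :
  tensor_assoc (tpure (tpure a b) c) = tpure a (tpure b c).
Proof. by rewrite !tensor_liftE. Qed.

End Associator.

Section AssociatorInverse.
Variables A B C : nmodType.

Definition tensor_assoc_inv :
    {additive tensor A (tensor B C) -> tensor (tensor A B) C} :=
  tensor_swap C (tensor A B) \o tensor_map idfun (tensor_swap B A)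
  \o tensor_assoc C B A
  \o tensor_map (tensor_swap B C) idfun \o tensor_swap A (tensor B C).

Lemma tensor_assoc_invE a b c :
  tensor_assoc_inv (tpure a (tpure b c)) = tpure (tpure a b) c.
Proof.
rewrite -[LHS]/(tensor_swap C (tensor A B) (tensor_map idfun (tensor_swap B A)
  (tensor_assoc C B A (tensor_map (tensor_swap B C) idfun
    (tensor_swap A (tensor B C) (tpure a (tpure b c))))))).
by rewrite tensor_swapE tensor_mapE tensor_swapE tensor_assocE tensor_mapE
  !tensor_swapE.
Qed.

End AssociatorInverse.

Section RightUnitor.
Variable A : nmodType.

Lemma tensor_runit_biadditive : biadditive (fun (a : A) (k : nat) => a *+ k).
Proof.
split=> [k|a]; split=> [|x y].
- exact: mul0rn.
- exact: mulrnDl.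
- exact: mulr0n.
- exact: mulrnDr.
Qed.

Definition tensor_runit : {additive tensor A nat -> A} :=
  tensor_lift tensor_runit_biadditive.

Definition tensor_runit_inv_fun (a : A) : tensor A nat := tpure a 1%N.

Lemma tensor_runit_inv_morphism : nmod_morphism tensor_runit_inv_fun.
Proof. by have [pl _] := tpure_biadditive A nat; exact: pl. Qed.

HB.instance Definition _ := GRing.isNmodMorphism.Build A (tensor A nat)
  tensor_runit_inv_fun tensor_runit_inv_morphism.

Definition tensor_runit_inv : {additive A -> tensor A nat} :=
  tensor_runit_inv_fun.

Lemma tensor_runit_invK : cancel tensor_runit_inv tensor_runit.
Proof. by move=> a; rewrite tensor_liftE mulr1n. Qed.

Lemma tensor_runitK : cancel tensor_runit tensor_runit_inv.
Proof.
suff e : (tensor_runit_inv \o tensor_runit : {additive _ -> _}) = idfun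
  by move=> x; move: (congr1 (fun h : {additive _ -> _} => h x) e).
apply: tensor_hom_ext => a k /=; rewrite tensor_liftE /= /tensor_runit_inv_fun.
have [pl pr] := tpure_biadditive A nat.
elim: k => [|k IHk]; first by rewrite mulr0n (pl _).1 -(pr a).1.
by rewrite mulrS (pl _).2 IHk -(pr a).2.
Qed.

End RightUnitor.

Section FreeRig.
Variable M : nmodType.

Inductive F0 : Type :=
| FZero
| FOne
| FVar of M
| FAdd of F0 & F0
| FMul of F0 & F0
| FApp of F0.

HB.instance Definition _ := gen_eqMixin F0.
HB.instance Definition _ := gen_choiceMixin F0.

Inductive F_rel : F0 -> F0 -> Prop :=
| F_refl a : F_rel a a
| F_sym a b : F_rel a b -> F_rel b a
| F_trans a b c : F_rel a b -> F_rel b c -> F_rel a c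
| F_addA a b c : F_rel (FAdd (FAdd a b) c) (FAdd a (FAdd b c))
| F_add0 a : F_rel (FAdd a FZero) a
| F_addC a b : F_rel (FAdd a b) (FAdd b a)
| F_mulA a b c : F_rel (FMul (FMul a b) c) (FMul a (FMul b c))
| F_mul1 a : F_rel (FMul a FOne) a
| F_mulC a b : F_rel (FMul a b) (FMul b a)
| F_mulDl a b c : F_rel (FMul (FAdd a b) c) (FAdd (FMul a c) (FMul b c))
| F_mul0 a : F_rel (FMul FZero a) FZero
| F_var0 : F_rel (FVar 0) FZero
| F_varD m n : F_rel (FAdd (FVar m) (FVar n)) (FVar (m + n))
| F_congrD a b c : F_rel a b -> F_rel (FAdd a c) (FAdd b c)
| F_congrM a b c : F_rel a b -> F_rel (FMul a c) (FMul b c)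
| F_congrf a b : F_rel a b -> F_rel (FApp a) (FApp b).

Definition F_relb (a b : F0) : bool := `[< F_rel a b >].

Lemma F_relb_equiv : equiv_class_of F_relb.
Proof.
split=> [a|a b|b a c].
- exact/asboolP/F_refl.
- by apply/asboolP/asboolP => /F_sym.
- by move=> /asboolP ab /asboolP bc; apply/asboolP/(F_trans ab bc).
Qed.

Canonical F_equiv := EquivRelPack F_relb_equiv.

Definition F : Type := {eq_quot F_equiv}.
HB.instance Definition _ := Choice.on F.
HB.instance Definition _ := EqQuotient.on F.

Definition F_class (a : F0) : F := \pi_F a.

Lemma F_eqP (a b : F0) : (F_class a = F_class b) <-> F_rel a b.
Proof. by split=> [/eqmodP/asboolP //|ab]; apply/eqmodP/asboolP. Qed.

Definition F_add (x y : F) : F := F_class (FAdd (repr x) (repr y)).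
Definition F_mul (x y : F) : F := F_class (FMul (repr x) (repr y)).

Lemma F_add_class a b : F_add (F_class a) (F_class b) = F_class (FAdd a b).
Proof.
have ea : F_rel (repr (F_class a)) a by apply/F_eqP; exact: reprK.
have eb : F_rel (repr (F_class b)) b by apply/F_eqP; exact: reprK.
apply/F_eqP/(F_trans (F_congrD _ ea))/(F_trans (F_addC _ _)).
exact/(F_trans (F_congrD _ eb))/F_addC.
Qed.

Lemma F_mul_class a b : F_mul (F_class a) (F_class b) = F_class (FMul a b).
Proof.
have ea : F_rel (repr (F_class a)) a by apply/F_eqP; exact: reprK.
have eb : F_rel (repr (F_class b)) b by apply/F_eqP; exact: reprK.
apply/F_eqP/(F_trans (F_congrM _ ea))/(F_trans (F_mulC _ _)).
exact/(F_trans (F_congrM _ eb))/F_mulC.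
Qed.

Lemma F_classW (P : F -> Prop) : (forall a, P (F_class a)) -> forall x, P x.
Proof. by move=> Pa; elim/quotW. Qed.

Lemma F_addA_subproof : associative F_add.
Proof.
elim/F_classW=> a; elim/F_classW=> b; elim/F_classW=> c.
by rewrite !F_add_class; apply/F_eqP/F_sym/F_addA.
Qed.

Lemma F_addC_subproof : commutative F_add.
Proof.
elim/F_classW=> a; elim/F_classW=> b.
by rewrite !F_add_class; apply/F_eqP/F_addC.
Qed.

Lemma F_add0_subproof : left_id (F_class FZero) F_add.
Proof.
elim/F_classW=> a; rewrite F_addC_subproof F_add_class.
exact/F_eqP/F_add0.
Qed.

Lemma F_mulA_subproof : associative F_mul.
Proof.
elim/F_classW=> a; elim/F_classW=> b; elim/F_classW=> c.
by rewrite !F_mul_class; apply/F_eqP/F_sym/F_mulA.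
Qed.

Lemma F_mulC_subproof : commutative F_mul.
Proof.
elim/F_classW=> a; elim/F_classW=> b.
by rewrite !F_mul_class; apply/F_eqP/F_mulC.
Qed.

Lemma F_mul1_subproof : left_id (F_class FOne) F_mul.
Proof.
elim/F_classW=> a; rewrite F_mulC_subproof F_mul_class.
exact/F_eqP/F_mul1.
Qed.

Lemma F_mulDl_subproof : left_distributive F_mul F_add.
Proof.
elim/F_classW=> a; elim/F_classW=> b; elim/F_classW=> c.
by rewrite !(F_add_class, F_mul_class); apply/F_eqP/F_mulDl.
Qed.

Lemma F_mul0_subproof : left_zero (F_class FZero) F_mul.
Proof. by elim/F_classW=> a; rewrite F_mul_class; apply/F_eqP/F_mul0. Qed.

HB.instance Definition _ := GRing.isNmodule.Build F
  F_addA_subproof F_addC_subproof F_add0_subproof.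

HB.instance Definition _ := GRing.Nmodule_isComPzSemiRing.Build F
  F_mulA_subproof F_mulC_subproof F_mul1_subproof F_mulDl_subproof
  F_mul0_subproof.

Lemma F_class0 : F_class FZero = 0. Proof. by []. Qed.
Lemma F_class1 : F_class FOne = 1. Proof. by []. Qed.
Lemma F_classD a b : F_class a + F_class b = F_class (FAdd a b).
Proof. exact: F_add_class. Qed.
Lemma F_classM a b : F_class a * F_class b = F_class (FMul a b).
Proof. exact: F_mul_class. Qed.

Definition eta_fun (k : nat) : F := F_class FOne *+ k.

Lemma eta_morphism : nmod_morphism eta_fun.
Proof. by split=> [|k l]; [exact: mulr0n | exact: mulrnDr]. Qed.

HB.instance Definition _ :=
  GRing.isNmodMorphism.Build nat F eta_fun eta_morphism.

Definition eta : {additive nat -> F} := eta_fun.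

Lemma mul_biadditive : biadditive (fun x y : F => x * y).
Proof.
split=> [y|x]; split=> [|u v].
- exact: mul0r.
- exact: mulrDl.
- exact: mulr0.
- exact: mulrDr.
Qed.

Definition nabla : {additive tensor F F -> F} := tensor_lift mul_biadditive.

Lemma nablaE a b :
  nabla (tpure (F_class a) (F_class b)) = F_class a * F_class b.
Proof. exact: tensor_liftE. Qed.

Lemma nabla_unique (h : {additive tensor F F -> F}) :
  (forall a b, h (tpure (F_class a) (F_class b)) = F_class a * F_class b) ->
  h = nabla.
Proof.
move=> hE; apply: tensor_hom_ext; elim/F_classW=> a; elim/F_classW=> b.
by rewrite hE nablaE.
Qed.

End FreeRig.

(* Main.v *)
Require Import Defs.
From mathcomp Require Import all_boot all_algebra.

(** A homomorphism out of a tensor product is determined by its values on pure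
    tensors, and [nabla M] sends the pure tensor of [x] and [y] to the product
    [x * y] of the rig [F M].  Evaluated on pure tensors, the three identities
    are therefore the axioms [(x * y) * z = x * (y * z)], [x * 1 = x] and
    [y * x = x * y] of a commutative rig.  Associativity concerns a threefold
    tensor product, where [tensor3_hom_ext] provides the reduction to iterated
    pure tensors. *)

(** For fixed [c], the values of [g] and [h] at [tpure x c] are additive in [x],
    so the determination by pure tensors can be used a second time, on the inner
    tensor product. *)
Lemma tensor3_hom_ext (A B C D : nmodType)
    (g h : {additive tensor (tensor A B) C -> D}) :
  (forall a b c, g (tpure (tpure a b) c) = h (tpure (tpure a b) c)) -> g = h.
Proof.
move=> gh; apply: tensor_hom_ext => x c.
have [pl _] := tpure_biadditive (tensor A B) C.
elim/tensor_classW: x; elim=> [|a b|s IHs t IHt].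
- rewrite -[tensor_class _]/(0%R : tensor A B) (pl c).1.
  by rewrite !GRing.raddf0.
- exact: gh.
- by rewrite tensor_piD (pl c).2 !GRing.raddfD IHs IHt.
Qed.

Lemma nabla_tpure (M : nmodType) (x y : F M) :
  nabla M (tpure x y) = (x * y)%R.
Proof. exact: tensor_liftE. Qed.

Theorem proposition5p3 (M : nmodType) :
  [/\ (nabla M \o tensor_map (nabla M) idfun
         : {additive tensor (tensor (F M) (F M)) (F M) -> F M})
      = (nabla M \o tensor_map idfun (nabla M)
           \o tensor_assoc (F M) (F M) (F M)),
      (nabla M \o tensor_map idfun (eta M) \o tensor_runit_inv (F M)
         : {additive F M -> F M})
      = idfun
    & (nabla M \o tensor_swap (F M) (F M)
         : {additive tensor (F M) (F M) -> F M})
      = nabla M ].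
Proof.
split.
- apply: tensor3_hom_ext => x y z.
  change (nabla M (tensor_map (nabla M) idfun (tpure (tpure x y) z)) =
    nabla M (tensor_map idfun (nabla M)
      (tensor_assoc (F M) (F M) (F M) (tpure (tpure x y) z)))).
  by rewrite tensor_assocE !tensor_mapE !nabla_tpure GRing.mulrA.
- apply: additive_ext => x.
  (* The inverse right unitor sends [x] to [tpure x 1], and [eta M 1] is the
     unit of the rig. *)
  change (nabla M (tensor_map idfun (eta M) (tpure x 1%N)) = x).
  by rewrite tensor_mapE nabla_tpure; exact: GRing.mulr1.
- apply: tensor_hom_ext => x y.
  change (nabla M (tensor_swap (F M) (F M) (tpure x y)) = nabla M (tpure x y)).
  by rewrite tensor_swapE !nabla_tpure GRing.mulrC.
Qed.
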